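(* Let $A$ be a cosemisimple Hopf algebra over an algebraically closed field $k$, let $R$ be a right $A$-comodule algebra, and let $V,W$ be objects of ${}_R\mathcal M_R^A$. If $f:V\to W$ is a linear map satisfying $$f(v\cdot x)=f(v)\cdot x\quad\text{and}\quad f(x\cdot v)=\rho(x)\cdot f(v)$$ for all $v\in V$ and $x\in R$, then $\mathbf M_{V,W}(f):V\to W$ is a morphism in the category ${}_R\mathcal M_R^A$.
   Context: ${}_R\mathcal M_R^A$ is the category of $R$-bimodules in the category of right $A$-comodules: objects are right $A$-comodules $V$ with an $R$-bimodule structure such that for all $x\in R$, $v\in V$: $(x\cdot v)_{(0)}\otimes(x\cdot v)_{(1)}=x_{(0)}\cdot v_{(0)}\otimes x_{(1)}v_{(1)}$ and $(v\cdot x)_{(0)}\otimes(v\cdot x)_{(1)}=v_{(0)}\cdot x_{(0)}\otimes v_{(1)}x_{(1)}$; morphisms are the $A$-colinear and $R$-bilinear maps. A cosemisimple Hopf algebra $A$ has a Haar integral $h:A\to k$, i.e. a linear map with $h(a_{(1)})a_{(2)}=h(a)1=h(a_{(2)})a_{(1)}$ for all $a$ and $h(1)=1$. For right $A$-comodules $V,W$ and a linear map $f:V\to W$, define $\mathbf M_{V,W}(f):V\to W$ by $$\mathbf M_{V,W}(f)(v)=h\big(f(v_{(0)})_{(1)}S(v_{(1)})\big)f(v_{(0)})_{(0)}.$$ Let $*$ be the convolution product. A modular functional on $A$ is a convolution invertible linear map $\psi:A\to k$ such that $S^2=\psi*\mathrm{id}*\psi^{-1}$, $\sigma:=\psi*\mathrm{id}*\psi$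 is an algebra automorphism of $A$, and $h(ab)=h(b\sigma(a))$ for all $a,b\in A$; it is a known fact that a modular functional exists on any cosemisimple Hopf algebra. Fix such a $\psi$. Then $\rho$ is the algebra automorphism of $R$ defined by $\rho(x)=\psi^{-2}(x_{(1)})x_{(0)}$, where $\psi^{-2}=\psi^{-1}*\psi^{-1}$. *)

(* Defs.v *)
From HB Require Import structures.
From mathcomp Require Import all_boot all_order all_algebra.
From mathcomp Require Import boolp.

Set Implicit Arguments.
Unset Strict Implicit.
Unset Printing Implicit Defensive.

Import GRing.Theory.
Local Open Scope ring_scope.
Local Open Scope quotient_scope.

Reserved Notation "v \ox w" (at level 40, left associativity).
Reserved Notation "\sw_ ( v , w <- t ) E"
  (at level 41, v name, w name, E at level 41,
   format "'[' \sw_ ( v ,  w  <-  t ) '/  '  E ']'").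
Reserved Notation "x *> v" (at level 40, left associativity).
Reserved Notation "v <* x" (at level 40, left associativity).

(* The tensor product of k-vector spaces: finite formal sums of pairs (v, w),
   written as sequences, modulo the congruence generated by commutativity of
   the formal sum and by the bilinearity relations.  Since (- v, w) is then
   opposite to (v, w), the quotient is a group. *)
Section Tensor.
Variables (k : fieldType) (V W : lmodType k).

Inductive tensor_rel : seq (V * W) -> seq (V * W) -> Prop :=
| TensorRefl s : tensor_rel s s
| TensorSym s t : tensor_rel s t -> tensor_rel t s
| TensorTrans s t u : tensor_rel s t -> tensor_rel t u -> tensor_rel s u
| TensorCat s s' t t' :
    tensor_rel s s' -> tensor_rel t t' -> tensor_rel (s ++ t) (s' ++ t')
| TensorC s t : tensor_rel (s ++ t) (t ++ s)
| TensorZero w : tensor_rel [:: (0, w)] [::]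
| TensorDl v v' w : tensor_rel [:: (v + v', w)] [:: (v, w); (v', w)]
| TensorDr v w w' : tensor_rel [:: (v, w + w')] [:: (v, w); (v, w')]
| TensorZ a v w : tensor_rel [:: (a *: v, w)] [:: (v, a *: w)].

Definition tensor_relb : rel (seq (V * W)) := fun s t => `[< tensor_rel s t >].

Lemma tensor_relb_equiv : equiv_class_of tensor_relb.
Proof.
split=> [s | s t | t s u].
- exact/asboolP/TensorRefl.
- by apply/idP/idP => /asboolP h; apply/asboolP/TensorSym.
- by move=> /asboolP h /asboolP h'; apply/asboolP/(TensorTrans h h').
Qed.

Canonical tensor_equiv := EquivRelPack tensor_relb_equiv.

Definition tensor := {eq_quot tensor_equiv}.

HB.instance Definition _ := Choice.on tensor.
HB.instance Definition _ := EqQuotient.on tensor.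

Lemma tensor_piP s t : \pi_tensor s = \pi_tensor t <-> tensor_rel s t.
Proof. by split=> [/eqmodP/asboolP | h]; last exact/eqmodP/asboolP. Qed.

Lemma tensor_reprP s : tensor_rel (repr (\pi_tensor s)) s.
Proof. by apply/tensor_piP; rewrite reprK. Qed.

Let scale_seq (a : k) (s : seq (V * W)) := [seq (a *: p.1, p.2) | p <- s].

Lemma tensor_rel_map (a : k) s t :
  tensor_rel s t -> tensor_rel (scale_seq a s) (scale_seq a t).
Proof.
elim=> {s t} [s | s t _ h | s t u _ h _ h' | s s' t t' _ h _ h' | s t | w
  | v v' w | v w w' | b v w].
- exact: TensorRefl.
- exact: TensorSym.
- exact: TensorTrans h h'.
- by rewrite /scale_seq !map_cat; apply: TensorCat.
- by rewrite /scale_seq !map_cat; apply: TensorC.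
- by rewrite /= scaler0; apply: TensorZero.
- by rewrite /= scalerDr; apply: TensorDl.
- exact: TensorDr.
- by rewrite /= scalerA mulrC -scalerA; apply: TensorZ.
Qed.

Definition tensor_zero : tensor := \pi_tensor [::].
Definition tensor_add (x y : tensor) : tensor := \pi_tensor (repr x ++ repr y).
Definition tensor_scale (a : k) (x : tensor) : tensor :=
  \pi_tensor [seq (a *: p.1, p.2) | p <- repr x].
Definition tensor_opp (x : tensor) : tensor := tensor_scale (-1) x.

Let addE s t : tensor_add (\pi s) (\pi t) = \pi_tensor (s ++ t).
Proof. by apply/tensor_piP/TensorCat; apply: tensor_reprP. Qed.

Let scaleE a s : tensor_scale a (\pi s) = \pi_tensor (scale_seq a s).
Proof. by apply/tensor_piP/tensor_rel_map/tensor_reprP. Qed.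

Let addA : associative tensor_add.
Proof. by elim/quotW=> s; elim/quotW=> t; elim/quotW=> u; rewrite !addE catA. Qed.

Let addC : commutative tensor_add.
Proof.
by elim/quotW=> s; elim/quotW=> t; rewrite !addE; apply/tensor_piP/TensorC.
Qed.

Let add0 : left_id tensor_zero tensor_add.
Proof. by elim/quotW=> s; rewrite addE. Qed.

Let scaleDl x a b :
  tensor_scale (a + b) x = tensor_add (tensor_scale a x) (tensor_scale b x).
Proof.
elim/quotW: x => s; rewrite !scaleE addE; apply/tensor_piP.
elim: s => [|[v w] s IHs] /=; first exact: TensorRefl.
rewrite scalerDl; apply: TensorTrans (TensorCat (TensorDl _ _ _) IHs) _.
apply: (TensorCat (TensorRefl [:: _])).
rewrite -cat_rcons -cats1 -cat1s !catA.
by apply: TensorCat; [apply: TensorC | apply: TensorRefl].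
Qed.

Let scale0 x : tensor_scale 0 x = tensor_zero.
Proof.
elim/quotW: x => s; rewrite !scaleE; apply/tensor_piP.
elim: s => [|[v w] s IHs] /=; first exact: TensorRefl.
by rewrite scale0r; apply: (TensorCat (TensorZero w) IHs).
Qed.

Let scale1 : left_id 1 tensor_scale.
Proof.
elim/quotW=> s; rewrite scaleE; congr (\pi_tensor _).
by rewrite -[RHS]map_id; apply: eq_map => -[v w]; rewrite /= scale1r.
Qed.

Let scaleA a b x : tensor_scale a (tensor_scale b x) = tensor_scale (a * b) x.
Proof.
elim/quotW: x => s; rewrite !scaleE; congr (\pi_tensor _).
by rewrite /scale_seq -map_comp; apply: eq_map => p; rewrite /= scalerA.
Qed.

Let scaleDr : right_distributive tensor_scale tensor_add.
Proof.
move=> a; elim/quotW=> s; elim/quotW=> t.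
by rewrite addE !scaleE addE /scale_seq map_cat.
Qed.

Let addN : left_inverse tensor_zero tensor_opp tensor_add.
Proof. by move=> x; rewrite -[X in tensor_add _ X]scale1 -scaleDl addNr. Qed.

HB.instance Definition _ := GRing.isZmodule.Build tensor addA addC add0 addN.
HB.instance Definition _ :=
  GRing.Zmodule_isLmodule.Build k tensor scaleA scale1 scaleDr
    (fun x a b => scaleDl x a b).

Definition pure (v : V) (w : W) : tensor := \pi_tensor [:: (v, w)].

(* \sw_(v, w <- t) b v w: the value at t of the linear map V (x) W -> U
   induced by the bilinear map b.  It is total in b, but independent of the
   chosen representative of t only when b is bilinear (see tlift_pure). *)
Definition tlift (U : nmodType) (t : tensor) (b : V -> W -> U) : U :=
  \sum_(p <- repr t) b p.1 p.2.

Definition bilinear_map (U : lmodType k) (b : V -> W -> U) : Prop :=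
  (forall w, linear (b^~ w)) /\ (forall v, linear (b v)).

Lemma tlift_pi (U : lmodType k) (b : V -> W -> U) s :
  bilinear_map b -> tlift (\pi_tensor s) b = \sum_(p <- s) b p.1 p.2.
Proof.
move=> [bl br]; rewrite /tlift.
have bDl v v' w : b (v + v') w = b v w + b v' w.
  by have := bl w 1 v v'; rewrite !scale1r.
have bDr v w w' : b v (w + w') = b v w + b v w'.
  by have := br v 1 w w'; rewrite !scale1r.
have b0l w : b 0 w = 0.
  by apply: (addrI (b 0 w)); rewrite -bDl !addr0.
have b0r v : b v 0 = 0.
  by apply: (addrI (b v 0)); rewrite -bDr !addr0.
move: (repr _) (tensor_reprP s) => r; elim=> {r s} [s | s t _ -> | s t u _ -> _ ->
  | s s' t t' _ h _ h' | s t | w | v v' w | v w w' | a v w] //.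
- by rewrite !big_cat h h'.
- by rewrite !big_cat /= addrC.
- by rewrite big_seq1 big_nil b0l.
- by rewrite !big_cons !big_nil /= bDl !addr0.
- by rewrite !big_cons !big_nil /= bDr !addr0.
- rewrite !big_seq1 /=; have := bl w a v 0; rewrite !addr0 b0l addr0 => ->.
  by have := br v a w 0; rewrite !addr0 b0r addr0 => ->.
Qed.

Lemma tlift_pure (U : lmodType k) (b : V -> W -> U) v w :
  bilinear_map b -> tlift (pure v w) b = b v w.
Proof. by move=> hb; rewrite tlift_pi // big_seq1. Qed.

Lemma tensor_addE s t :
  \pi_tensor s + \pi_tensor t = \pi_tensor (s ++ t) :> tensor.
Proof. exact: addE. Qed.

Lemma tlift_linear (U : lmodType k) (b : V -> W -> U) :
  bilinear_map b -> linear (fun t => tlift t b).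
Proof.
move=> hb a; elim/quotW=> s; elim/quotW=> t.
rewrite [a *: _]scaleE tensor_addE !tlift_pi // big_cat /= scaler_sumr big_map.
congr (_ + _); apply: eq_bigr => -[v w] _ /=.
have [bl _] := hb; have := bl w a v 0; have := bl w 1 0 0.
by rewrite !scale1r !addr0 -[LHS]addr0 => /addrI <-; rewrite addr0.
Qed.

Lemma pure_bilinear : bilinear_map (pure : V -> W -> tensor).
Proof.
have pZ a v w : a *: pure v w = pure (a *: v) w by exact: scaleE.
split=> [w a v v' | v a w w'].
- by rewrite pZ tensor_addE; apply/tensor_piP/TensorDl.
- rewrite pZ tensor_addE; apply/tensor_piP.
  apply: TensorTrans (TensorDr _ _ _) _.
  by apply: (@TensorCat [:: _] [:: _] [:: _] [:: _]);
    [apply/TensorSym/TensorZ | apply: TensorRefl].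
Qed.

Lemma tensor_sum_pure (t : tensor) : t = \sum_(p <- repr t) pure p.1 p.2.
Proof.
rewrite -[LHS]reprK; elim: (repr t) => [|[v w] s IHs]; first by rewrite big_nil.
by rewrite big_cons -IHs tensor_addE.
Qed.

End Tensor.

Notation "v \ox w" := (pure v w) : ring_scope.
Notation "\sw_ ( v , w <- t ) E" := (tlift t (fun v w => E)) : ring_scope.

HB.mixin Record isCoalgebra (k : fieldType) C of GRing.Lmodule k C := {
  comul : {linear C -> tensor C C};
  counit : {scalar C};
  comulA : forall c,
    \sw_(c1, c2 <- comul c) \sw_(c11, c12 <- comul c1) c11 \ox (c12 \ox c2) =
    \sw_(c1, c2 <- comul c) \sw_(c21, c22 <- comul c2) c1 \ox (c21 \ox c22);
  counitl : forall c, \sw_(c1, c2 <- comul c) (counit c1 *: c2) = c;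
  counitr : forall c, \sw_(c1, c2 <- comul c) (counit c2 *: c1) = c
}.

#[short(type="coalgType")]
HB.structure Definition Coalgebra (k : fieldType) :=
  {C of GRing.Lmodule k C & isCoalgebra k C}.

HB.mixin Record isHopf (k : fieldType) A
    of GRing.Algebra k A & Coalgebra k A := {
  comul1 : comul (1 : A) = (1 : A) \ox (1 : A);
  comulM : forall a b : A, comul (a * b) =
    \sw_(a1, a2 <- comul a) \sw_(b1, b2 <- comul b) (a1 * b1) \ox (a2 * b2);
  counit1 : counit (1 : A) = 1;
  counitM : forall a b : A, counit (a * b) = counit a * counit b;
  antipode : {linear A -> A};
  antipodel : forall a : A,
    \sw_(a1, a2 <- comul a) (antipode a1 * a2) = (counit a)%:A;
  antipoder : forall a : A,
    \sw_(a1, a2 <- comul a) (a1 * antipode a2) = (counit a)%:A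
}.

#[short(type="hopfAlgType")]
HB.structure Definition HopfAlgebra (k : fieldType) :=
  {A of GRing.Algebra k A & Coalgebra k A & isHopf k A}.

HB.mixin Record isComodule (k : fieldType) (C : coalgType k) V
    of GRing.Lmodule k V := {
  coact : {linear V -> tensor V C};
  coactA : forall v,
    \sw_(v0, v1 <- coact v) \sw_(v00, v01 <- coact v0) v00 \ox (v01 \ox v1) =
    \sw_(v0, v1 <- coact v) \sw_(c1, c2 <- comul v1) v0 \ox (c1 \ox c2);
  coact_counit : forall v, \sw_(v0, v1 <- coact v) (counit v1 *: v0) = v
}.

#[short(type="comodType")]
HB.structure Definition Comodule (k : fieldType) (C : coalgType k) :=
  {V of GRing.Lmodule k V & isComodule k C V}.

HB.mixin Record isComoduleAlgebra (k : fieldType) (A : hopfAlgType k) R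
    of GRing.Algebra k R & Comodule k A R := {
  coact1 : coact (1 : R) = (1 : R) \ox (1 : A);
  coactM : forall x y : R, coact (x * y) =
    \sw_(x0, x1 <- coact x) \sw_(y0, y1 <- coact y)
      (x0 * y0) \ox (x1 * y1)
}.

#[short(type="comodAlgType")]
HB.structure Definition ComoduleAlgebra (k : fieldType) (A : hopfAlgType k) :=
  {R of GRing.Algebra k R & Comodule k A R & isComoduleAlgebra k A R}.

(* The objects of the category of R-bimodules in right A-comodules. *)
HB.mixin Record isComoduleBimodule (k : fieldType) (A : hopfAlgType k)
    (R : comodAlgType A) V of Comodule k A V := {
  lact : R -> V -> V;
  ract : V -> R -> V;
  lact_linearl : forall v, linear (lact^~ v);
  lact_linearr : forall x, linear (lact x);
  ract_linearl : forall x, linear (ract^~ x);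
  ract_linearr : forall v, linear (ract v);
  lact1 : forall v, lact 1 v = v;
  lactM : forall x y v, lact (x * y) v = lact x (lact y v);
  ract1 : forall v, ract v 1 = v;
  ractM : forall v x y, ract v (x * y) = ract (ract v x) y;
  lractA : forall x v y, ract (lact x v) y = lact x (ract v y);
  coact_lact : forall x v, coact (lact x v) =
    \sw_(x0, x1 <- coact x) \sw_(v0, v1 <- coact v)
      (lact x0 v0) \ox (x1 * v1);
  coact_ract : forall v x, coact (ract v x) =
    \sw_(v0, v1 <- coact v) \sw_(x0, x1 <- coact x)
      (ract v0 x0) \ox (v1 * x1)
}.

#[short(type="comodBimodType")]
HB.structure Definition ComoduleBimodule (k : fieldType) (A : hopfAlgType k)
    (R : comodAlgType A) :=
  {V of Comodule k A V & isComoduleBimodule k A R V}.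

Notation "x *> v" := (lact x v) : ring_scope.
Notation "v <* x" := (ract v x) : ring_scope.

Definition colinear (k : fieldType) (C : coalgType k) (V W : comodType C)
    (g : V -> W) : Prop :=
  forall v, coact (g v) = \sw_(v0, v1 <- coact v) (g v0) \ox v1.

Definition comod_bimod_morphism (k : fieldType) (A : hopfAlgType k)
    (R : comodAlgType A) (V W : comodBimodType R) (g : V -> W) : Prop :=
  [/\ linear g, colinear g,
      forall (x : R) v, g (x *> v) = x *> g v
    & forall v (x : R), g (v <* x) = g v <* x].

(* P is a linear subspace, given by its membership predicate, whose coaction
   lands in the image of P (x) C -> V (x) C. *)
Definition subcomodule (k : fieldType) (C : coalgType k) (V : comodType C)
    (P : V -> Prop) : Prop :=
  [/\ P 0, forall (a : k) u v, P u -> P v -> P (a *: u + v)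
    & forall v, P v -> exists2 s : seq (V * C),
        forall p, p \in s -> P p.1 & coact v = \sum_(p <- s) p.1 \ox p.2].

Definition semisimple_comodule (k : fieldType) (C : coalgType k)
    (V : comodType C) : Prop :=
  forall P : V -> Prop, subcomodule P ->
    exists Q : V -> Prop,
      [/\ subcomodule Q, forall v, P v -> Q v -> v = 0
        & forall v, exists u w, [/\ P u, Q w & v = u + w]].

(* The category of right A-comodules is semisimple: every subobject of every
   object is a direct summand. *)
Definition cosemisimple (k : fieldType) (A : hopfAlgType k) : Prop :=
  forall V : comodType A, semisimple_comodule V.

Section HaarModular.
Variables (k : fieldType) (A : hopfAlgType k).
Implicit Types (h psi : {scalar A}) (a b : A).

Definition haar_integral h : Prop :=
  [/\ forall a, \sw_(a1, a2 <- comul a) (h a1 *: a2) = (h a)%:A,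
      forall a, \sw_(a1, a2 <- comul a) (h a2 *: a1) = (h a)%:A
    & h 1 = 1].

Definition conv (B : pzSemiRingType) (f g : A -> B) : A -> B :=
  fun a => \sw_(a1, a2 <- comul a) (f a1 * g a2).

Definition conv_inverse psi psi' : Prop :=
  (forall a, conv psi psi' a = counit a) /\
  (forall a, conv psi' psi a = counit a).

(* A functional seen in Hom(A, A) through the unit map k -> A, so that it can
   be convolved with the identity of A. *)
Definition in_alg_fun psi : A -> A := fun a => (psi a)%:A.

Definition algebra_automorphism (s : A -> A) : Prop :=
  [/\ linear s, monoid_morphism s & bijective s].

Definition modular_sigma psi : A -> A :=
  conv (conv (in_alg_fun psi) id) (in_alg_fun psi).

(* psi is a modular functional with convolution inverse psi'. *)
Definition modular_functional h psi psi' : Prop :=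
  [/\ conv_inverse psi psi',
      forall a, antipode (antipode a) =
        conv (conv (in_alg_fun psi) id) (in_alg_fun psi') a,
      algebra_automorphism (modular_sigma psi)
    & forall a b, h (a * b) = h (b * modular_sigma psi a)].

(* The map rho of a comodule algebra R, for psi' the convolution inverse of the
   modular functional: psi^-2 is psi' * psi'. *)
Definition modular_rho (R : comodAlgType A) psi' : R -> R :=
  fun x => \sw_(x0, x1 <- coact x) (conv psi' psi' x1 *: x0).

(* The operator M_(V, W) attached to the Haar integral h. *)
Definition averaging h (V W : comodType A) (f : V -> W) : V -> W :=
  fun v => \sw_(v0, v1 <- coact v) \sw_(w0, w1 <- coact (f v0))
    (h (w1 * antipode v1) *: w0).

End HaarModular.

(* Main.v *)
Require Import Defs.
From HB Require Import structures.
From mathcomp Require Import all_boot all_order all_algebra.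

Set Implicit Arguments.
Unset Strict Implicit.
Unset Printing Implicit Defensive.

Import GRing.Theory.
Local Open Scope ring_scope.

(** Write M for the averaging operator: the projection of linear maps onto
    colinear maps given by the Haar integral.  Each of the three compatibilities
    of M f comes down to one identity in A, obtained once the coactions have
    been expanded and coassociativity applied.

    Colinearity.  The identity is a1 h(a2 S(b)) = h(a S(b1)) b2
    ([haar_antipode_swap]).  By right invariance of h, the right-hand side is
    a1 S(b1)_1 h(a2 S(b1)_2) b2, and S(b1)_1 b2 (x) S(b1)_2 = 1 (x) S(b)
    ([comul_antipode_cancel]).

    Right R-linearity.  M f (v x) contains x1 S(v1 x2) = eps(x) S(v1)
    ([antipode_cancel]), so the coefficients of x cancel.

    Left R-linearity.  The order of the factors is now wrong: the twist of f by
    rho leads to psi^-2(x2) h(x1 c S(x3)), where c stands between x1 and S(x3).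
    The modular property of h moves x1 past the rest, as sigma(x1).  Since
    sigma = psi * id * psi and S^2 = psi * id * psi^-1, the factor psi^-2 turns
    sigma(x1) into S^2(x1) ([conv_sigma_inv]), and S(x2) S^2(x1) = S(S(x1) x2)
    collapses to eps(x) ([haar_modular_cancel]).  This is why f has to be
    twisted by rho for M f to be left linear. *)

(** * Sweedler sums and linearity *)

Section Sweedler.
Variables (k : fieldType) (V W : lmodType k).

Lemma eq_tlift (U : nmodType) (t : tensor V W) (b b' : V -> W -> U) :
  (forall v w, b v w = b' v w) -> tlift t b = tlift t b'.
Proof. by move=> eq_b; apply: eq_bigr => p _. Qed.

Lemma exchange_tlift (V' W' : lmodType k) (U : nmodType) (t : tensor V W)
    (s : tensor V' W') (b : V -> W -> V' -> W' -> U) :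
  \sw_(v, w <- t) \sw_(v', w' <- s) b v w v' w' =
  \sw_(v', w' <- s) \sw_(v, w <- t) b v w v' w'.
Proof. exact: exchange_big. Qed.

Lemma tlift_tpure (t : tensor V W) : \sw_(v, w <- t) v \ox w = t.
Proof. by rewrite [RHS]tensor_sum_pure. Qed.

(** A Sweedler sum is an honest finite sum over a chosen representative, and the
    linear map g acts on each of its terms. *)
Lemma linear_tlift (U U' : lmodType k) (g : U -> U') (t : tensor V W)
    (b : V -> W -> U) :
  linear g -> g (tlift t b) = \sw_(v, w <- t) g (b v w).
Proof.
move=> lin_g.
pose g' : {linear U -> U'} :=
  HB.pack g (GRing.isLinear.Build k U U' *:%R g lin_g).
exact: (linear_sum g').
Qed.

Lemma scalar_tlift (U : lmodType k) (h : {scalar U}) (t : tensor V W)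
    (b : V -> W -> U) :
  h (tlift t b) = \sw_(v, w <- t) h (b v w).
Proof. exact: linear_sum. Qed.

Lemma scaler_tliftl (U : lmodType k) (t : tensor V W) (b : V -> W -> k)
    (u : U) :
  (tlift t b) *: u = \sw_(v, w <- t) b v w *: u.
Proof. exact: scaler_suml. Qed.

Lemma scaler_tliftr (U : lmodType k) (t : tensor V W) (b : V -> W -> U)
    (a : k) :
  a *: tlift t b = \sw_(v, w <- t) (a *: b v w).
Proof. exact: scaler_sumr. Qed.

Lemma tlift_mull (U : pzRingType) (t : tensor V W) (b : V -> W -> U) (u : U) :
  u * (tlift t b) = \sw_(v, w <- t) u * b v w.
Proof. exact: mulr_sumr. Qed.

Lemma tlift_mulr (U : pzRingType) (t : tensor V W) (b : V -> W -> U) (u : U) :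
  (tlift t b) * u = \sw_(v, w <- t) b v w * u.
Proof. exact: mulr_suml. Qed.

Lemma linear_id : linear (fun v : V => v).
Proof. by []. Qed.

Lemma linear_app (X : lmodType k) (f : {linear V -> W}) (g : X -> V) :
  linear g -> linear (fun x => f (g x)).
Proof. by move=> lin_g a x y; rewrite lin_g linearP. Qed.

Lemma linear_scaler (X : lmodType k) (a : k) (g : X -> V) :
  linear g -> linear (fun x => a *: g x).
Proof. by move=> lin_g b x y; rewrite lin_g scalerDr !scalerA mulrC. Qed.

Lemma linear_scalel (X : lmodType k) (h : {scalar V}) (g : X -> V) (w : W) :
  linear g -> linear (fun x => h (g x) *: w).
Proof. by move=> lin_g b x y; rewrite lin_g linearP scalerDl scalerA. Qed.

Lemma linear_purel (X : lmodType k) (g : X -> V) (w : W) :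
  linear g -> linear (fun x => g x \ox w).
Proof.
by move=> lin_g b x y; rewrite lin_g; apply: (proj1 (pure_bilinear V W)).
Qed.

Lemma linear_purer (X : lmodType k) (v : V) (g : X -> W) :
  linear g -> linear (fun x => v \ox g x).
Proof.
by move=> lin_g b x y; rewrite lin_g; apply: (proj2 (pure_bilinear V W)).
Qed.

Lemma linear_tliftl (X U : lmodType k) (g : X -> tensor V W)
    (b : V -> W -> U) :
  bilinear_map b -> linear g -> linear (fun x => tlift (g x) b).
Proof. by move=> bil_b lin_g a x y; rewrite lin_g tlift_linear. Qed.

Lemma linear_tliftr (X U : lmodType k) (t : tensor V W)
    (b : X -> V -> W -> U) :
  (forall v w, linear (fun x => b x v w)) -> linear (fun x => tlift t (b x)).
Proof.
move=> lin_b a x y; rewrite /tlift scaler_sumr -big_split.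
by apply: eq_bigr => p _; apply: lin_b.
Qed.

End Sweedler.

Section LinearMul.
Variables (k : fieldType) (A : algType k) (X : lmodType k).

Lemma linear_mull (a : A) (g : X -> A) :
  linear g -> linear (fun x => a * g x).
Proof. by move=> lin_g b x y; rewrite lin_g mulrDr scalerAr. Qed.

Lemma linear_mulr (a : A) (g : X -> A) :
  linear g -> linear (fun x => g x * a).
Proof. by move=> lin_g b x y; rewrite lin_g mulrDl scalerAl. Qed.

End LinearMul.

Section LinearAct.
Variables (k : fieldType) (A : hopfAlgType k) (R : comodAlgType A).
Variables (V : comodBimodType R) (X : lmodType k).

Lemma linear_lactl (v : V) (g : X -> R) :
  linear g -> linear (fun x => g x *> v).
Proof. by move=> lin_g b x y; rewrite lin_g; apply: lact_linearl. Qed.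

Lemma linear_lactr (r : R) (g : X -> V) :
  linear g -> linear (fun x => r *> g x).
Proof. by move=> lin_g b x y; rewrite lin_g; apply: lact_linearr. Qed.

Lemma linear_ractl (r : R) (g : X -> V) :
  linear g -> linear (fun x => g x <* r).
Proof. by move=> lin_g b x y; rewrite lin_g; apply: ract_linearl. Qed.

Lemma linear_ractr (v : V) (g : X -> R) :
  linear g -> linear (fun x => v <* g x).
Proof. by move=> lin_g b x y; rewrite lin_g; apply: ract_linearr. Qed.

End LinearAct.

(** The scalar conv psi psi' (g x) is itself a Sweedler sum, so its linearity is
    that of the sum of the vectors psi b * psi' c *: u. *)
Lemma linear_conv_scalel (k : fieldType) (A : hopfAlgType k)
    (X U : lmodType k) (psi psi' : {scalar A}) (g : X -> A) (u : U) :
  linear g -> linear (fun x => conv psi psi' (g x) *: u).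
Proof.
move=> lin_g a x y; rewrite !scaler_tliftl.
apply: (linear_tliftl (g := fun x => comul (g x))
  (b := fun b c => psi b * psi' c *: u)); last exact: linear_app.
split=> [b c x1 x2 | b c x1 x2].
  by rewrite linearP mulrDl scalerDl -mulrA scalerA.
by rewrite linearP mulrDr scalerDl mulrCA scalerA.
Qed.

Definition trilinear_map (k : fieldType) (V1 V2 V3 U : lmodType k)
    (T : V1 -> V2 -> V3 -> U) : Prop :=
  [/\ forall y z, linear (fun x => T x y z),
      forall x z, linear (fun y => T x y z)
    & forall x y, linear (T x y)].

(** The axioms of coalgebras and comodules may be applied inside a Sweedler sum
    whose summand is linear in each component; this tactic proves such facts by
    following the syntax of the summand down to the variable. *)
Ltac linear_tac := cbv beta; first [by [] |
  lazymatch goal with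
  | |- bilinear_map _ =>
      let w := fresh in split=> w; linear_tac
  | |- trilinear_map _ =>
      let w := fresh in let w' := fresh in split=> w w'; linear_tac
  | |- GRing.linear_for _ (fun x => x) => exact: linear_id
  | |- GRing.linear_for _ (fun x => tlift (@?g x) (@?b x)) =>
      lazymatch g with
      | fun _ => ?t =>
          let v := fresh in let w := fresh in
          apply: (linear_tliftr t (b := b)) => v w; linear_tac
      | _ => apply: (linear_tliftl (g := g)); linear_tac
      end
  | |- GRing.linear_for _ (fun x => pure (@?g x) (@?b x)) =>
      lazymatch g with
      | fun _ => ?t => apply: (linear_purer t (g := b)); linear_tac
      | _ => apply: (linear_purel _ (g := g)); linear_tac
      end
  | |- GRing.linear_for _ (fun x => lact (@?g x) (@?b x)) =>
      lazymatch g with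
      | fun _ => ?t => apply: (linear_lactr t (g := b)); linear_tac
      | _ => apply: (linear_lactl _ (g := g)); linear_tac
      end
  | |- GRing.linear_for _ (fun x => ract (@?g x) (@?b x)) =>
      lazymatch g with
      | fun _ => ?t => apply: (linear_ractr t (g := b)); linear_tac
      | _ => apply: (linear_ractl _ (g := g)); linear_tac
      end
  | |- GRing.linear_for _ (fun x => GRing.mul (@?g x) (@?b x)) =>
      lazymatch g with
      | fun _ => ?t => apply: (linear_mull t (g := b)); linear_tac
      | _ => apply: (linear_mulr _ (g := g)); linear_tac
      end
  | |- GRing.linear_for _ (fun x => GRing.scale (@?a x) (@?g x)) =>
      lazymatch a with
      | fun _ => ?c => apply: (linear_scaler c (g := g)); linear_tac
      | fun y => GRing.Linear.sort ?h (@?b y) =>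
          apply: (linear_scalel h _ (g := b)); linear_tac
      | fun y => conv (GRing.Linear.sort ?p) (GRing.Linear.sort ?q) (@?b y) =>
          apply: (linear_conv_scalel p q _ (g := b)); linear_tac
      end
  | |- GRing.linear_for _ (fun x => GRing.Linear.sort ?f (@?g x)) =>
      apply: (linear_app f (g := g)); linear_tac
  end].

Section TliftTensor.
Variables (k : fieldType) (V W : lmodType k).

Lemma linearZ_fun (g : V -> W) (a : k) (v : V) :
  linear g -> g (a *: v) = a *: g v.
Proof.
move=> lin_g.
pose g' : {linear V -> W} :=
  HB.pack g (GRing.isLinear.Build k V W *:%R g lin_g).
exact: (linearZ_LR g').
Qed.

Lemma tlift_tlift (V' W' U : lmodType k) (t : tensor V W)
    (b : V -> W -> tensor V' W') (B : V' -> W' -> U) :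
  bilinear_map B ->
  tlift (tlift t b) B = \sw_(v, w <- t) \sw_(v', w' <- b v w) B v' w'.
Proof.
move=> bil_B; apply: (linear_tlift (g := fun x => tlift x B)).
exact: tlift_linear.
Qed.

End TliftTensor.

(** The shape of both sides of a coassociativity axiom, which a trilinear map
    turns into a plain double Sweedler sum. *)
Lemma tlift_pure3 (k : fieldType) (V W V' W' V1 V2 V3 U : lmodType k)
    (t : tensor V W) (s : V -> W -> tensor V' W')
    (X1 : V -> W -> V' -> W' -> V1)
    (X2 : V -> W -> V' -> W' -> V2) (X3 : V -> W -> V' -> W' -> V3)
    (T : V1 -> V2 -> V3 -> U) : trilinear_map T ->
  \sw_(x, u <- \sw_(v, w <- t) \sw_(v', w' <- s v w)
     X1 v w v' w' \ox (X2 v w v' w' \ox X3 v w v' w')) tlift u (T x) =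
  \sw_(v, w <- t) \sw_(v', w' <- s v w)
     T (X1 v w v' w') (X2 v w v' w') (X3 v w v' w').
Proof.
move=> [T1 T2 T3].
have bilT x : bilinear_map (T x) by split.
have bilB : bilinear_map (fun x u => tlift u (T x)) by linear_tac.
rewrite tlift_tlift //; apply: eq_tlift => v w.
rewrite tlift_tlift //; apply: eq_tlift => v' w'.
by rewrite !tlift_pure.
Qed.

(** * Coalgebra and comodule axioms inside a multilinear expression *)

Section Coassociativity.
Variables (k : fieldType) (C : coalgType k) (V : comodType C) (U : lmodType k).

Lemma tlift_comulA (T : C -> C -> C -> U) (c : C) : trilinear_map T ->
  \sw_(c1, c2 <- comul c) \sw_(c11, c12 <- comul c1) T c11 c12 c2 =
  \sw_(c1, c2 <- comul c) \sw_(c21, c22 <- comul c2) T c1 c21 c22.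
Proof.
move=> triT; pose B x u := tlift u (T x).
by have := congr1 (fun t => tlift t B) (comulA c); rewrite !tlift_pure3.
Qed.

Lemma tlift_coactA (T : V -> C -> C -> U) (v : V) : trilinear_map T ->
  \sw_(v0, v1 <- coact v) \sw_(v00, v01 <- coact v0) T v00 v01 v1 =
  \sw_(v0, v1 <- coact v) \sw_(c1, c2 <- comul v1) T v0 c1 c2.
Proof.
move=> triT; pose B x u := tlift u (T x).
by have := congr1 (fun t => tlift t B) (coactA v); rewrite !tlift_pure3.
Qed.

Lemma tlift_counitl (g : C -> U) (c : C) : linear g ->
  \sw_(c1, c2 <- comul c) (counit c1 *: g c2) = g c.
Proof.
move=> lin_g; rewrite -[in RHS](counitl c) (linear_tlift _ _ lin_g).
by apply: eq_tlift => c1 c2; rewrite linearZ_fun.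
Qed.

Lemma tlift_counitr (g : C -> U) (c : C) : linear g ->
  \sw_(c1, c2 <- comul c) (counit c2 *: g c1) = g c.
Proof.
move=> lin_g; rewrite -[in RHS](counitr c) (linear_tlift _ _ lin_g).
by apply: eq_tlift => c1 c2; rewrite linearZ_fun.
Qed.

Lemma tlift_coact_counit (g : V -> U) (v : V) : linear g ->
  \sw_(v0, v1 <- coact v) (counit v1 *: g v0) = g v.
Proof.
move=> lin_g; rewrite -[in RHS](coact_counit v) (linear_tlift _ _ lin_g).
by apply: eq_tlift => v0 v1; rewrite linearZ_fun.
Qed.

End Coassociativity.

Section CoactionProducts.
Variables (k : fieldType) (A : hopfAlgType k) (R : comodAlgType A).
Variables (V : comodBimodType R) (U : lmodType k).

Lemma tlift_comulM (b : A -> A -> U) (x y : A) : bilinear_map b ->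
  tlift (comul (x * y)) b =
  \sw_(x1, x2 <- comul x) \sw_(y1, y2 <- comul y) b (x1 * y1) (x2 * y2).
Proof.
move=> bil_b; rewrite comulM tlift_tlift //; apply: eq_tlift => x1 x2.
by rewrite tlift_tlift //; apply: eq_tlift => y1 y2; rewrite tlift_pure.
Qed.

Lemma tlift_coact_lact (b : V -> A -> U) (x : R) (v : V) : bilinear_map b ->
  tlift (coact (x *> v)) b =
  \sw_(x0, x1 <- coact x) \sw_(v0, v1 <- coact v) b (x0 *> v0) (x1 * v1).
Proof.
move=> bil_b; rewrite coact_lact tlift_tlift //; apply: eq_tlift => x0 x1.
by rewrite tlift_tlift //; apply: eq_tlift => v0 v1; rewrite tlift_pure.
Qed.

Lemma tlift_coact_ract (b : V -> A -> U) (v : V) (x : R) : bilinear_map b ->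
  tlift (coact (v <* x)) b =
  \sw_(v0, v1 <- coact v) \sw_(x0, x1 <- coact x) b (v0 <* x0) (v1 * x1).
Proof.
move=> bil_b; rewrite coact_ract tlift_tlift //; apply: eq_tlift => v0 v1.
by rewrite tlift_tlift //; apply: eq_tlift => x0 x1; rewrite tlift_pure.
Qed.

End CoactionProducts.

(** * The antipode *)

Section Antipode.
Variables (k : fieldType) (A : hopfAlgType k).
Implicit Types (a b c x y : A).

Lemma antipode1 : antipode (1 : A) = 1.
Proof.
have := antipodel (1 : A); rewrite comul1 tlift_pure; last by linear_tac.
by rewrite mulr1 counit1 scale1r.
Qed.

(** Insert eps(y1) 1 = S(y1) y2 on the left: then y2 x1 S(y3 x2) is
    z1 S(z2) for z = y2 x. *)
Lemma antipode_cancel x y :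
  \sw_(x1, x2 <- comul x) (x1 * antipode (y * x2)) =
  counit x *: antipode y.
Proof.
transitivity (\sw_(y1, y2 <- comul y) (antipode y1 *
   \sw_(y21, y22 <- comul y2) \sw_(x1, x2 <- comul x)
     ((y21 * x1) * antipode (y22 * x2)))).
  under [RHS]eq_tlift => y1 y2.
    rewrite tlift_mull.
    under eq_tlift => y21 y22.
      rewrite tlift_mull.
      under eq_tlift => x1 x2 do rewrite 2!mulrA.
      over.
    over.
  rewrite -tlift_comulA; last by linear_tac.
  under [RHS]eq_tlift => y1 y2.
    rewrite exchange_tlift.
    under eq_tlift => x1 x2.
      under eq_tlift => y11 y12 do rewrite -mulrA.
      rewrite -tlift_mulr antipodel mulr_algl.
      over.
    over.
  rewrite exchange_tlift; apply: eq_tlift => x1 x2.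
  by rewrite tlift_counitl //; linear_tac.
under eq_tlift => y1 y2.
  rewrite -(tlift_comulM (b := fun a b => a * antipode b)); last by linear_tac.
  rewrite antipoder counitM mulr_algr mulrC -scalerA.
  over.
by rewrite -(tlift_counitr (g := fun a => counit x *: antipode a));
  [apply: eq_tlift => y1 y2; rewrite !scalerA mulrC | linear_tac].
Qed.

(** Both sides are S(y1) y2 S(x y3), contracted either at S(y1) y2 or, by
    [antipode_cancel], at y2 S(x y3). *)
Lemma antipodeM x y : antipode (x * y) = antipode y * antipode x.
Proof.
transitivity (\sw_(y1, y2 <- comul y) (antipode y1 *
   \sw_(y21, y22 <- comul y2) (y21 * antipode (x * y22)))).
  under [RHS]eq_tlift => y1 y2.
    rewrite tlift_mull.
    under eq_tlift => y21 y22 do rewrite mulrA.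
    over.
  rewrite -tlift_comulA; last by linear_tac.
  under [RHS]eq_tlift => y1 y2 do rewrite -tlift_mulr antipodel mulr_algl.
  by rewrite (tlift_counitl (g := fun b => antipode (x * b))) //; linear_tac.
under eq_tlift => y1 y2 do rewrite antipode_cancel -scalerAr.
by rewrite (tlift_counitr (g := fun b => antipode b * antipode x)) //;
  linear_tac.
Qed.

(** A form of the anticomultiplicativity of S.  Insert eps(b3) 1 = b3 S(b4) on
    the right of the second factor: then b1, b2 and b3 contribute
    Delta (S(b1) b2), which is trivial. *)
Lemma comul_antipode_cancel b :
  \sw_(b1, b2 <- comul b) \sw_(s1, s2 <- comul (antipode b1))
    (s1 * b2) \ox s2 = 1 \ox antipode b.
Proof.
transitivity (\sw_(b1, b2 <- comul b) \sw_(b11, b12 <- comul b1)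
   \sw_(s1, s2 <- comul (antipode b11)) \sw_(c1, c2 <- comul b12)
     (s1 * c1) \ox (s2 * (c2 * antipode b2))).
  rewrite tlift_comulA; last by linear_tac.
  apply: eq_tlift => b1 b2; rewrite [RHS]exchange_tlift.
  apply: eq_tlift => s1 s2; rewrite tlift_comulA; last by linear_tac.
  under [RHS]eq_tlift => b21 b22.
    rewrite -(linear_tlift (g := fun a => (s1 * b21) \ox (s2 * a)));
      last by linear_tac.
    rewrite antipoder mulr_algr.
    rewrite (linearZ_fun (g := fun a => (s1 * b21) \ox a)); last by linear_tac.
    over.
  by rewrite (tlift_counitr (g := fun a => (s1 * a) \ox s2)) //; linear_tac.
under eq_tlift => b1 b2.
  under eq_tlift => b11 b12.
    under eq_tlift => s1 s2 do under eq_tlift => c1 c2 do rewrite mulrA.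
    rewrite -(tlift_comulM (b := fun p q => p \ox (q * antipode b2)));
      last by linear_tac.
    over.
  rewrite -(linear_tlift
    (g := fun a => \sw_(p, q <- comul a) (p \ox (q * antipode b2))));
    last by linear_tac.
  rewrite antipodel (linearZ_fun
    (g := fun a => \sw_(p, q <- comul a) (p \ox (q * antipode b2))));
    last by linear_tac.
  rewrite comul1 tlift_pure; last by linear_tac.
  rewrite mul1r.
  over.
by rewrite (tlift_counitl (g := fun a => 1 \ox antipode a)) //; linear_tac.
Qed.

End Antipode.

(** * The Haar integral and modular functionals *)

Section Haar.
Variables (k : fieldType) (A : hopfAlgType k).
Variables (h : {scalar A}).
Implicit Types (a b c x y : A).

(** Right invariance of h at a S(b1) produces S(b1)_1 b2 (x) S(b1)_2, which
    [comul_antipode_cancel] evaluates. *)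
Lemma haar_antipode_swap a b : haar_integral h ->
  \sw_(a1, a2 <- comul a) (h (a2 * antipode b) *: a1) =
  \sw_(b1, b2 <- comul b) (h (a * antipode b1) *: b2).
Proof.
case=> _ h_r _.
(* Read h (a * S b1) as the scalar h (a * S b1) *: 1, to which invariance
   applies. *)
under [RHS]eq_tlift => b1 b2.
  rewrite -mulr_algl -h_r tlift_mulr tlift_comulM; last by linear_tac.
  rewrite exchange_tlift.
  over.
rewrite /=.
transitivity (\sw_(b1, b2 <- comul b) \sw_(s1, s2 <- comul (antipode b1))
    \sw_(a1, a2 <- comul a) h (a2 * s2) *: (a1 * (s1 * b2))); last first.
  apply: eq_tlift => b1 b2; apply: eq_tlift => s1 s2; apply: eq_tlift => a1 a2.
  by rewrite -scalerAl mulrA.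
transitivity (\sw_(p, q <- 1 \ox antipode b)
    \sw_(a1, a2 <- comul a) h (a2 * q) *: (a1 * p)).
  rewrite tlift_pure; last by linear_tac.
  by apply: eq_tlift => a1 a2; rewrite mulr1.
rewrite -comul_antipode_cancel tlift_tlift; last by linear_tac.
apply: eq_tlift => b1 b2; rewrite tlift_tlift; last by linear_tac.
by apply: eq_tlift => s1 s2; rewrite tlift_pure; last by linear_tac.
Qed.

End Haar.

Section Convolution.
Variables (k : fieldType) (A : hopfAlgType k).
Implicit Types (a b c : A) (psi : {scalar A}).

Lemma linear_in_alg_fun psi : linear (in_alg_fun psi).
Proof. by rewrite /in_alg_fun; linear_tac. Qed.

Lemma linear_conv (f g : A -> A) : linear f -> linear g -> linear (conv f g).
Proof.
move=> lin_f lin_g; rewrite /conv; apply: linear_tliftl; last exact: linearP.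
by split=> w; [apply: linear_mulr | apply: linear_mull].
Qed.

Lemma convA (f g e : A -> A) : linear f -> linear g -> linear e ->
  conv (conv f g) e =1 conv f (conv g e).
Proof.
move=> lin_f lin_g lin_e a; rewrite /conv.
under eq_tlift => a1 a2 do rewrite tlift_mulr.
rewrite tlift_comulA; last first.
  by split=> x y; [do 2![apply: linear_mulr] |
    apply: linear_mulr; apply: linear_mull | apply: linear_mull].
by apply: eq_tlift => a1 a2; rewrite tlift_mull; apply: eq_tlift => *;
  rewrite mulrA.
Qed.

Lemma conv_in_alg_inv psi psi' a : conv_inverse psi psi' ->
  conv (in_alg_fun psi) (in_alg_fun psi') a = (counit a)%:A.
Proof.
case=> psiK _; rewrite -psiK /conv scaler_tliftl; apply: eq_tlift => a1 a2.
by rewrite /in_alg_fun mulr_algl scalerA.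
Qed.

End Convolution.

Section Modular.
Variables (k : fieldType) (A : hopfAlgType k).
Variables (h psi psi' : {scalar A}).
Implicit Types (a b c : A).

(** In the convolution algebra this reads
    (psi * id * psi) * psi^-2 = psi * id * psi^-1. *)
Lemma conv_sigma_inv a : modular_functional h psi psi' ->
  \sw_(a1, a2 <- comul a) (conv psi' psi' a2 *: modular_sigma psi a1) =
  antipode (antipode a).
Proof.
case=> psiK S2 _ _.
have lin := @linear_in_alg_fun _ A; have lin_id := linear_id (V := A).
have lin_l : linear (conv (in_alg_fun psi) id) by apply: linear_conv.
have conv_psi'2 b : (conv psi' psi' b)%:A =
    conv (in_alg_fun psi') (in_alg_fun psi') b.
  rewrite /conv scaler_tliftl; apply: eq_tlift => b1 b2.
  by rewrite /in_alg_fun mulr_algl scalerA.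
rewrite S2.
transitivity (conv (modular_sigma psi)
   (conv (in_alg_fun psi') (in_alg_fun psi')) a).
  by apply: eq_tlift => a1 a2; rewrite -conv_psi'2 mulr_algr.
(* Regroup as (psi * id) * (psi * (psi^-1 * psi^-1)), and simplify the right
   factor to psi^-1. *)
rewrite (convA _ (lin psi)) //; last exact: linear_conv (lin psi') (lin psi').
apply: eq_tlift => a1 a2; congr (_ * _).
rewrite -convA //.
transitivity (conv (fun b => (counit b)%:A) (in_alg_fun psi') a2).
  by apply: eq_tlift => b1 b2; rewrite conv_in_alg_inv.
rewrite -[RHS](tlift_counitl _ (lin psi')).
by apply: eq_tlift => b1 b2; rewrite mulr_algl.
Qed.

(** Moving a1 to the far right costs sigma, and psi^-2 corrects sigma to S^2;
    what remains is S(a2) S^2(a1) = S(S(a1) a2). *)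
Lemma haar_modular_cancel a c : modular_functional h psi psi' ->
  \sw_(a1, a2 <- comul a) \sw_(a11, a12 <- comul a1)
    (conv psi' psi' a12 * h (a11 * (c * antipode a2))) = counit a * h c.
Proof.
move=> psi_modular; have [_ _ _ h_twist] := psi_modular.
transitivity (h (c * \sw_(a1, a2 <- comul a) (antipode a2 *
   \sw_(a11, a12 <- comul a1) (conv psi' psi' a12 *: modular_sigma psi a11)))).
  rewrite tlift_mull scalar_tlift; apply: eq_tlift => a1 a2.
  rewrite 2!tlift_mull scalar_tlift; apply: eq_tlift => a11 a12.
  by rewrite h_twist -!scalerAr linearZ mulrA.
under eq_tlift => a1 a2 do rewrite conv_sigma_inv // -antipodeM.
rewrite -(linear_tlift (g := antipode)) ?antipodel; last exact: linearP.
by rewrite linearZ antipode1 -scalerAr mulr1 linearZ.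
Qed.

End Modular.

(** * The averaging operator *)

Section Averaging.
Variables (k : fieldType) (A : hopfAlgType k) (h : {scalar A}).

Lemma averaging_linear (V W : comodType A) (f : {linear V -> W}) :
  linear (averaging h f).
Proof. by rewrite /averaging; linear_tac. Qed.

(** The coaction of M f v is h(w2 S(v1)) w0 (x) w1 for w = f(v0), while the
    colinear value is h(w1 S(v1)) w0 (x) v2: the swap identity relates them. *)
Lemma averaging_colinear (V W : comodType A) (f : {linear V -> W}) :
  haar_integral h -> colinear (averaging h f).
Proof.
move=> h_haar v; rewrite /averaging.
rewrite (linear_tlift (g := coact)); last exact: linearP.
under eq_tlift => v0 v1.
  rewrite (linear_tlift (g := coact)); last exact: linearP.
  under eq_tlift => w0 w1.
    rewrite linearZ /= -[coact w0]tlift_tpure.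
    rewrite scaler_tliftr.
    over.
  rewrite tlift_coactA; last by linear_tac.
  (* The swap identity lives in A, so w0 \ox _ is pulled out of the sum. *)
  under eq_tlift => w0 w1.
    under eq_tlift => a1 a2.
      rewrite -(linearZ_fun (g := fun a => w0 \ox a)); last by linear_tac.
      over.
    rewrite -(linear_tlift (g := fun a => w0 \ox a)); last by linear_tac.
    rewrite haar_antipode_swap //.
    rewrite (linear_tlift (g := fun a => w0 \ox a)); last by linear_tac.
    under eq_tlift => c1 c2.
      rewrite (linearZ_fun (g := fun a => w0 \ox a)); last by linear_tac.
      over.
    over.
  rewrite exchange_tlift.
  over.
under [RHS]eq_tlift => v0 v1.
  rewrite (linear_tlift (g := fun w => w \ox v1)); last by linear_tac.
  under eq_tlift => v00 v01.
    rewrite (linear_tlift (g := fun w => w \ox v1)); last by linear_tac.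
    under eq_tlift => w0 w1.
      rewrite (linearZ_fun (g := fun w => w \ox v1)); last by linear_tac.
      over.
    over.
  over.
by rewrite /= -tlift_coactA; last by linear_tac.
Qed.

Variables (R : comodAlgType A) (V W : comodBimodType R).

(** Both f(v x) and S(v1 x1) see x; coassociativity on x gathers the two
    coefficients into x1 S(v1 x2), which cancels. *)
Lemma averaging_ract (f : {linear V -> W}) v (x : R) :
    (forall v (x : R), f (v <* x) = f v <* x) ->
  averaging h f (v <* x) = averaging h f v <* x.
Proof.
move=> f_ract; rewrite /averaging tlift_coact_ract; last by linear_tac.
rewrite (linear_tlift (g := fun w => w <* x)); last by linear_tac.
apply: eq_tlift => v0 v1.
under eq_tlift => x0 x1.
  rewrite f_ract tlift_coact_ract; last by linear_tac.
  over.
rewrite exchange_tlift (linear_tlift (g := fun w => w <* x));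
  last by linear_tac.
apply: eq_tlift => w0 w1; rewrite tlift_coactA; last by linear_tac.
rewrite (linearZ_fun (g := fun w => w <* x)); last by linear_tac.
rewrite -[in RHS](tlift_coact_counit (g := fun x => w0 <* x));
  last by linear_tac.
rewrite scaler_tliftr; apply: eq_tlift => x0 x1.
rewrite -scaler_tliftl scalerA; congr (_ *: _).
under eq_tlift => c1 c2 do rewrite -mulrA.
by rewrite -scalar_tlift -tlift_mull antipode_cancel -scalerAr linearZ mulrC.
Qed.

(** The coaction of rho(x) is psi^-2(x2) x0 (x) x1, so f(x v) and S(x1 v1)
    together produce psi^-2(x2) h(x1 w1 S(v1) S(x3)). *)
Lemma averaging_lact (psi psi' : {scalar A}) (f : {linear V -> W}) (x : R) v :
    modular_functional h psi psi' ->
    (forall (x : R) v, f (x *> v) = modular_rho psi' x *> f v) ->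
  averaging h f (x *> v) = x *> averaging h f v.
Proof.
move=> psi_modular f_lact; rewrite /averaging tlift_coact_lact;
  last by linear_tac.
rewrite exchange_tlift (linear_tlift (g := fun w => x *> w));
  last by linear_tac.
apply: eq_tlift => v0 v1.
under eq_tlift => x0 x1.
  rewrite f_lact tlift_coact_lact; last by linear_tac.
  rewrite (linear_tlift (g := fun r => \sw_(r0, r1 <- coact r)
    \sw_(w0, w1 <- coact (f v0))
      (h (r1 * w1 * antipode (x1 * v1)) *: (r0 *> w0)))); last by linear_tac.
  under eq_tlift => r0 r1.
    rewrite (linearZ_fun (g := fun r => \sw_(r0, r1 <- coact r)
      \sw_(w0, w1 <- coact (f v0))
        (h (r1 * w1 * antipode (x1 * v1)) *: (r0 *> w0)))); last by linear_tac.
    rewrite scaler_tliftr.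
    over.
  rewrite tlift_coactA; last by linear_tac.
  over.
rewrite tlift_coactA; last by linear_tac.
rewrite (linear_tlift (g := fun w => x *> w)); last by linear_tac.
(* The sum over the coaction of f v0 moves outermost, to compare termwise. *)
under eq_tlift => x0 x1.
  under eq_tlift => a1 a2.
    under eq_tlift => c1 c2 do rewrite scaler_tliftr.
    rewrite exchange_tlift.
    over.
  rewrite exchange_tlift.
  over.
rewrite exchange_tlift; apply: eq_tlift => w0 w1.
rewrite (linearZ_fun (g := fun w => x *> w)); last by linear_tac.
rewrite -[in RHS](tlift_coact_counit (g := fun x => x *> w0));
  last by linear_tac.
rewrite scaler_tliftr; apply: eq_tlift => x0 x1.
rewrite scalerA [in RHS]mulrC -(haar_modular_cancel _ _ psi_modular).
rewrite scaler_tliftl; apply: eq_tlift => a1 a2.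
rewrite scaler_tliftl; apply: eq_tlift => c1 c2.
by rewrite scalerA antipodeM !mulrA.
Qed.

End Averaging.

Theorem lemma5p3 (k : closedFieldType) (A : hopfAlgType k)
    (A_cosemisimple : cosemisimple A)
    (h : {scalar A}) (h_haar : haar_integral h)
    (psi psi' : {scalar A}) (psi_modular : modular_functional h psi psi')
    (R : comodAlgType A) (V W : comodBimodType R) (f : {linear V -> W})
    (f_ract : forall (v : V) (x : R), f (v <* x) = f v <* x)
    (f_lact : forall (x : R) (v : V), f (x *> v) = modular_rho psi' x *> f v) :
  comod_bimod_morphism (R := R) (averaging h f).
Proof.
split=> [||x v|v x].
- exact: averaging_linear.
- exact: averaging_colinear.
- exact: averaging_lact psi_modular f_lact.
- exact: averaging_ract.
Qed.
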